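(* Let $A=(a_1,\dots,a_n)$ be a finite sequence and $k$ a positive integer. Let $s$ be a real-valued function on the blocks of $A$ such that (i) $s(\emptyset)=0$ and $s(B)\ge 0$ for every block $B$, and (ii) $s(B_1)\le s(B_2)\le s(B_1)+1$ whenever $B_1\subset B_2$ are blocks and $B_2\setminus B_1$ is a singleton. Then there is a partition of $A$ into $k$ blocks $B_1,\dots,B_k$ such that $|s(B_i)-s(B_j)|\le 1$ for all $i,j\in[k]$.
   Context: A block of $A$ is either the empty set or a set of consecutive terms $\{a_i,a_{i+1},\dots,a_j\}$ with $i\le j$ (regarded as the set of positions $\{i,\dots,j\}$). A partition of $A$ into $k$ blocks is an ordered tuple $(B_1,\dots,B_k)$ given by integers $0=x_0\le x_1\le\dots\le x_k=n$ with $B_i=\{a_j:x_{i-1}<j\le x_i\}$; empty blocks are allowed. *)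

(* Defs.v *)
From mathcomp Require Import all_boot all_order all_algebra.
From mathcomp Require Import reals.

Set Implicit Arguments.
Unset Strict Implicit.
Unset Printing Implicit Defensive.

(* Positions are numbered from 0: the term a_j of a sequence of length n is   *)
(* position j - 1 in 'I_n.                                                    *)

Definition is_block (n : nat) (B : {set 'I_n}) : Prop :=
  B = set0 \/
  exists i j : 'I_n, (i <= j)%N /\ B = [set l : 'I_n | (i <= l <= j)%N].

(* Only the values x 0, ..., x k of the cut-point function matter. With       *)
(* positions and block indices both shifted by one, the condition             *)
(* x_(i-1) < j <= x_i on 1-based indices reads x i <= l < x i.+1.             *)
Definition is_block_partition (n k : nat) (B : k.-tuple {set 'I_n}) : Prop :=
  exists x : nat -> nat,
    [/\ x 0%N = 0%N,
        x k = n,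
        forall i : nat, (i < k)%N -> (x i <= x i.+1)%N
      & forall i : 'I_k, tnth B i = [set l : 'I_n | (x i <= l < x i.+1)%N]].

(* Main.v *)
Require Import Defs.
From mathcomp Require Import all_boot all_order all_algebra.
From mathcomp Require Import boolp reals.
From mathcomp Require Import lra zify.

Import Order.TTheory GRing.Theory Num.Theory.
Local Open Scope ring_scope.

(** Write [f x y] for the value of [s] on the block of positions in [[x, y)].
    Choose cut points [p] for which the minimum [t] of the block values is as
    large as possible, and let [q] be the greedy cut points: each block is the
    longest one of value at most [t + 1].  A greedy block that stops before [n]
    has value greater than [t], so by maximality of [t] the greedy cut points
    reach [n] within [k] blocks; for the same reason [p] may be replaced by
    [min p q].  The points between [p i] and [q i] are then all attainable as
    the end of [i] blocks with values in [[t, t + 1]]: this goes by induction on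
    [i], by a discrete intermediate value argument for [x |-> f x y].  As
    [p k = q k = n], this gives the partition. *)

Definition cutpoints (n k : nat) (x : nat -> nat) : Prop :=
  [/\ x 0%N = 0%N, x k = n & forall i, (i < k)%N -> (x i <= x i.+1)%N].

Lemma cutpoints_le {n k x} :
  cutpoints n k x -> forall i, (i <= k)%N -> (x i <= n)%N.
Proof.
move=> [_ <- xS] i; elim: k xS => [|k IHk] xS; first by case: i.
rewrite leq_eqVlt => /predU1P[-> //|ltik].
by rewrite (leq_trans (IHk _ ltik)) ?xS // => j ltjk; rewrite xS // ltnW.
Qed.

(** A downward step of [g] is at most 1, so [g] cannot jump over the window from [t] to [t + 1].
    Upward jumps are harmless: the first value at most [t + 1] is taken. *)
Lemma discrete_ivt (R : realDomainType) (g : nat -> R) (t : R) (a b : nat) :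
  (forall x, g x <= g x.+1 + 1) -> (a <= b)%N -> t <= g a -> g b <= t + 1 ->
  exists x, [/\ (a <= x)%N, (x <= b)%N & t <= g x <= t + 1].
Proof.
move=> gS /subnKC <-; move: (b - a)%N => d.
elim: d a => [|d IHd] a ta.
  by rewrite addn0 => bt; exists a; rewrite ta bt.
rewrite addnS -addSn => bt.
have [at1|at1] := lerP (g a) (t + 1); first by exists a; rewrite ta at1; split; lia.
have [|x [ax xb tx]] := IHd a.+1 _ bt; first by have := gS a; lra.
by exists x; split=> //; lia.
Qed.

Section IntervalFunction.

Context {R : realDomainType} {f : nat -> nat -> R}.
Hypothesis f0 : forall x y, (y <= x)%N -> f x y = 0.
Hypothesis fSl : forall x y, f x.+1 y <= f x y <= f x.+1 y + 1.
Hypothesis fSr : forall x y, f x y <= f x y.+1 <= f x y + 1.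

Lemma interval_monol y x x' : (x <= x')%N -> f x' y <= f x y.
Proof.
move=> /subnKC <-; elim: (x' - x)%N => [|d IHd]; first by rewrite addn0.
by rewrite addnS (le_trans _ IHd) //; case/andP: (fSl (x + d) y).
Qed.

Lemma interval_monor x y y' : (y <= y')%N -> f x y <= f x y'.
Proof.
move=> /subnKC <-; elim: (y' - y)%N => [|d IHd]; first by rewrite addn0.
by rewrite addnS (le_trans IHd) //; case/andP: (fSr x (y + d)).
Qed.

Lemma interval_ge0 x y : 0 <= f x y.
Proof. by rewrite -(f0 x 0) // interval_monor. Qed.

(** The least block value of any cut points is one of the finitely many [f a b] with [a, b <= n], so
    a best common lower bound exists. *)
Lemma maximin_cutpoints (n k : nat) : (0 < k)%N ->
  exists t p, [/\ 0 <= t, cutpoints n k p,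
    forall i, (i < k)%N -> t <= f (p i) (p i.+1) &
    forall x, cutpoints n k x ->
      ~ forall i, (i < k)%N -> t < f (x i) (x i.+1)].
Proof.
move=> k_gt0.
pose feasible (t : R) := exists2 p, cutpoints n k p &
  forall i, (i < k)%N -> t <= f (p i) (p i.+1).
pose F (ab : 'I_n.+1 * 'I_n.+1) := f ab.1 ab.2.
have F00 : `[< feasible (F (ord0, ord0)) >].
  apply/asboolP; exists (fun i => if i == 0%N then 0%N else n).
    by split=> [||[|i] _] //=; rewrite gtn_eqF.
  by move=> i _; rewrite /F f0 // interval_ge0.
case: (@Order.TotalTheory.arg_maxP _ _ _ _ (fun ab => `[< feasible (F ab) >]) F F00).
move=> ab /asboolP[p p_cut p_ge] ab_max.
exists (F ab), p; split=> // [|x x_cut x_gt]; first exact: interval_ge0.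
pose G (i : 'I_k) := f (x i) (x i.+1).
case: (@Order.TotalTheory.arg_minP _ _ _ (Ordinal k_gt0) predT G isT) => i _ i_min.
have xi : (x i < n.+1)%N by rewrite ltnS (cutpoints_le x_cut) // ltnW.
have xSi : (x i.+1 < n.+1)%N by rewrite ltnS (cutpoints_le x_cut).
have /ab_max : `[< feasible (F (Ordinal xi, Ordinal xSi)) >].
  by apply/asboolP; exists x => // j ltjk; exact: (i_min (Ordinal ltjk)).
by apply/negP; rewrite -ltNge x_gt.
Qed.

(** For [0 <= c] and [x <= n] the candidate [y = x] qualifies, so the default 0 of an empty maximum
    does not interfere. *)
Definition greedy_end (n : nat) (c : R) (x : nat) : nat :=
  \max_(y < n.+1 | f x y <= c) y.

Lemma greedy_endP n c x : 0 <= c -> (x <= n)%N ->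
  [/\ (x <= greedy_end n c x <= n)%N, f x (greedy_end n c x) <= c &
      (greedy_end n c x < n)%N -> c < f x (greedy_end n c x).+1].
Proof.
move=> c_ge0 xn.
have Px : f x (Ordinal (xn : (x < n.+1)%N)) <= c by rewrite f0.
have max_ge (y : 'I_n.+1) : f x y <= c -> (y <= greedy_end n c x)%N.
  by move=> Py; apply: (@leq_bigmax_cond _ (fun y : 'I_n.+1 => f x y <= c) (@nat_of_ord _)).
have [|y Py yE] := @eq_bigmax_cond _ (fun y : 'I_n.+1 => f x y <= c) (@nat_of_ord _).
  by apply/card_gt0P; exists (Ordinal (xn : (x < n.+1)%N)).
split; first by rewrite (max_ge _ Px) /greedy_end yE -ltnS ltn_ord.
  by rewrite /greedy_end yE.
move=> ltyn; rewrite ltNge; apply/negP => PS.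
by have := max_ge (Ordinal (ltyn : ((greedy_end n c x).+1 < n.+1)%N)) PS; rewrite /= ltnn.
Qed.

Lemma balanced_cutpoints (n k : nat) : (0 < k)%N ->
  exists t x, cutpoints n k x /\
    forall i, (i < k)%N -> t <= f (x i) (x i.+1) <= t + 1.
Proof.
move=> k_gt0; have [t [p [t_ge0 p_cut p_ge t_max]]] := maximin_cutpoints n k k_gt0.
have t1_ge0 : 0 <= t + 1 by lra.
pose q i := iter i (greedy_end n (t + 1)) 0%N.
have qn i : (q i <= n)%N.
  elim: i => [|i IHi] //=.
  by have [/andP[]] := greedy_endP n (t + 1) (q i) t1_ge0 IHi.
have qP i := greedy_endP n (t + 1) (q i) t1_ge0 (qn i).
have qS i : (q i <= q i.+1)%N by have [/andP[]] := qP i.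
have q_le i : f (q i) (q i.+1) <= t + 1 by have [] := qP i.
(* One term beyond [q i.+1] the value exceeds [t + 1], and that term adds at most 1. *)
have q_gt i : (q i.+1 < n)%N -> t < f (q i) (q i.+1).
  have [_ _ gt] := qP i => /gt; have := fSr (q i) (q i.+1); rewrite /= -/(q i.+1).
  move=> /andP[_ leS] gtS; rewrite -(ltrD2r 1); exact: lt_le_trans leS.
have qk : q k = n.
  apply/eqP; rewrite eqn_leq qn leqNgt; apply/negP => qk_lt.
  have q_lt i : (i <= k)%N -> (q i < n)%N.
    move=> ik; apply: leq_ltn_trans qk_lt.
    by move: ik => /subnKC <-; elim: (k - i)%N => [|d IHd]; rewrite ?addn0 // addnS (leq_trans IHd).
  (* Stretching the last greedy block to [n] gives [k] blocks of value above [t], against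
     maximality. *)
  apply: (t_max (fun i => if (i < k)%N then q i else n)).
    by split=> [||i ik]; rewrite ?k_gt0 ?ltnn // ik; case: ifP.
  move=> i ik; rewrite ik (lt_le_trans (q_gt i (q_lt i.+1 ik))) //.
  by case: ifP => // _; exact: interval_monor.
pose r i := minn (p i) (q i).
have [p0 pk pS] := p_cut.
have r_ge i : (i < k)%N -> t <= f (r i) (r i.+1).
  (* The block ends with the [i]-th block of [p] or of [q] and starts no later. In the second case
     [q i.+1 < p i.+1 <= n], so [q_gt] applies. *)
  move=> ik; rewrite {2}/r; case: (leqP (p i.+1) (q i.+1)) => [_|lt_qp].
    by rewrite (le_trans (p_ge i ik)) // interval_monol // geq_minl.
  have /q_gt/ltW : (q i.+1 < n)%N by rewrite (leq_trans lt_qp) // (cutpoints_le p_cut).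
  by move/le_trans; apply; rewrite interval_monol // geq_minr.
(* All end points from [r i] to [q i] are needed, since the induction picks the start of the last
   block within such a range. *)
have reach i y : (i <= k)%N -> (r i <= y)%N -> (y <= q i)%N ->
    exists x, cutpoints y i x /\
      forall j, (j < i)%N -> t <= f (x j) (x j.+1) <= t + 1.
  elim: i y => [|i IHi] y ik ry yq.
    by exists (fun=> 0%N); split=> //; split=> //; move: yq; rewrite leqn0 => /eqP.
  have rS : (r i <= r i.+1)%N by rewrite /r; have := pS i ik; have := qS i; lia.
  (* The start of the last block moves right from [r i], where the value is at least [t] because
     [r i.+1 <= y]. At [y] the block is empty; at [q i] its value is at most [t + 1] because
     [y <= q i.+1]. *)
  have [||||z [rz zq tz]] :=
    @discrete_ivt _ (fun x => f x y) t (r i) (minn (q i) y).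
  - by move=> x; case/andP: (fSl x y).
  - by rewrite leq_min geq_minr (leq_trans rS).
  - by rewrite (le_trans (r_ge i ik)) // interval_monor.
  - rewrite /minn; case: ltnP => _; last by rewrite f0.
    by rewrite (le_trans _ (q_le i)) // interval_monor.
  move: zq; rewrite leq_min => /andP[zq zy].
  have [x [[x0 xi xS] xt]] := IHi z (ltnW ik) rz zq.
  exists (fun j => if (j <= i)%N then x j else y); split.
    split=> [//||j]; first by rewrite ltnn.
    by rewrite ltnS => ji; rewrite ji; case: ltngtP ji => // [ji|->] _; rewrite ?xS ?xi.
  by move=> j; rewrite ltnS => ji; rewrite ji; case: ltngtP ji => // [ji|->] _; rewrite ?xt ?xi.
have [||x x_ok] := reach k n (leqnn k); rewrite ?qk //.
  by rewrite geq_min pk leqnn.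
by exists t, x.
Qed.

End IntervalFunction.

Definition interval_set (n x y : nat) : {set 'I_n} := [set l : 'I_n | (x <= l < y)%N].

Lemma interval_set_block n x y : is_block (interval_set n x y).
Proof.
have [->|/set0Pn[l]] := eqVneq (interval_set n x y) set0; first by left.
rewrite inE => /andP[xl ly]; right.
have xn : (x < n)%N by exact: leq_ltn_trans xl (ltn_ord l).
(* The end [y] is exclusive and may exceed [n], hence the predecessor and the truncation. *)
have yn : ((minn y n).-1 < n)%N by have := ltn_ord l; lia.
exists (Ordinal xn), (Ordinal yn); split; first by have := ltn_ord l; rewrite /=; lia.
by apply/setP => m; rewrite !inE /=; have := ltn_ord m; lia.
Qed.

Section BlockStep.

Context {R : realDomainType} {n : nat} {s : {set 'I_n} -> R}.
Hypothesis s_step : forall B1 B2 : {set 'I_n},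
  is_block B1 -> is_block B2 -> B1 \subset B2 ->
  (exists p : 'I_n, B2 :\: B1 = [set p]) -> s B1 <= s B2 /\ s B2 <= s B1 + 1.

(* The two intervals may coincide, since cut points may be out of order or
   beyond [n]. *)
Lemma interval_set_step x y x' y' p :
  interval_set n x y \subset interval_set n x' y' ->
  (forall l : 'I_n, l \in interval_set n x' y' :\: interval_set n x y -> l = p :> nat) ->
  s (interval_set n x y) <= s (interval_set n x' y') <= s (interval_set n x y) + 1.
Proof.
move=> sub diff.
have [D0|/set0Pn[l lD]] := eqVneq (interval_set n x' y' :\: interval_set n x y) set0.
  have -> : interval_set n x' y' = interval_set n x y.
    by apply/eqP; rewrite eqEsubset sub -setD_eq0 D0 eqxx.
  by rewrite lexx /= lerDl ler01.
apply/andP/s_step => //; try exact: interval_set_block.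
exists l; apply/setP => m; rewrite in_set1; apply/idP/eqP => [mD|-> //].
by apply/val_inj; rewrite /= (diff m mD) (diff l lD).
Qed.

End BlockStep.

Theorem theorem4p1 (R : realType) (T : Type) (A : seq T) (k : nat)
    (hk : (0 < k)%N)
    (s : {set 'I_(size A)} -> R)
    (s_empty : s set0 = 0)
    (s_ge0 : forall B : {set 'I_(size A)}, is_block B -> 0 <= s B)
    (s_step : forall B1 B2 : {set 'I_(size A)},
        is_block B1 -> is_block B2 -> B1 \subset B2 ->
        (exists p : 'I_(size A), B2 :\: B1 = [set p]) ->
        s B1 <= s B2 /\ s B2 <= s B1 + 1) :
  exists B : k.-tuple {set 'I_(size A)},
    is_block_partition B /\
    forall i j : 'I_k, `|s (tnth B i) - s (tnth B j)| <= 1.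
Proof.
set n := size A in s s_empty s_ge0 s_step *.
pose f x y := s (interval_set n x y).
have f0 x y : (y <= x)%N -> f x y = 0.
  move=> yx; rewrite -s_empty; congr s; apply/setP => l; rewrite !inE; lia.
have fSl x y : f x.+1 y <= f x y <= f x.+1 y + 1.
  (* Only position [x] can separate the two intervals. *)
  apply: (interval_set_step s_step _ _ _ _ x); first by apply/subsetP => l; rewrite !inE; lia.
  by move=> l; rewrite !inE; lia.
have fSr x y : f x y <= f x y.+1 <= f x y + 1.
  apply: (interval_set_step s_step _ _ _ _ y); first by apply/subsetP => l; rewrite !inE; lia.
  by move=> l; rewrite !inE; lia.
have [t [x [[x0 xk xS] xt]]] := balanced_cutpoints f0 fSl fSr n k hk.
exists [tuple interval_set n (x i) (x i.+1) | i < k]; split.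
  by exists x; split=> // i; rewrite tnth_mktuple.
move=> i j; rewrite !tnth_mktuple ler_norml.
by have := xt i (ltn_ord i); have := xt j (ltn_ord j); rewrite /f; lra.
Qed.
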